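(* Let $\mathcal{H}_k$ be a tridiagonal space corresponding to the orthonormal basis $f_n(z)=(a_n+b_nz)z^n$, $n\ge 0$. Let $P$ be a positive bounded operator on $\mathcal{H}_k$ with matrix representation $$P=\begin{bmatrix}c_{00}&c_{01}&c_{02}&c_{03}&\cdots\\ \bar c_{01}&c_{11}&c_{12}&c_{13}&\cdots\\ \bar c_{02}&\bar c_{12}&c_{22}&c_{23}&\cdots\\ \bar c_{03}&\bar c_{13}&\bar c_{23}&c_{33}&\cdots\\ \vdots&\vdots&\vdots&\vdots&\ddots\end{bmatrix}$$ with respect to the basis $\{f_n\}_{n\ge 0}$ (that is, $c_{mn}=\langle Pf_n,f_m\rangle_{\mathcal{H}_k}$ for $m\le n$). Then the positive definite scalar kernel $K$ defined by $$K(z,w)=\langle P\,k(\cdot,w),k(\cdot,z)\rangle_{\mathcal{H}_k}\qquad(z,w\in\mathbb{D})$$ is tridiagonal if and only if $$c_{0n}=(-1)^{n-1}\frac{\bar b_1\cdots\bar b_{n-1}}{\bar a_2\cdots\bar a_n}\,c_{01}\qquad(n\ge 2)$$ and $$c_{mn}=(-1)^{n-m-1}\frac{\bar b_{m+1}\cdots\bar b_{n-1}}{\bar a_{m+2}\cdots\bar a_n}\,c_{m,m+1}\qquad(1\le m\le n-2).$$ Equivalently, $K$ is tridiagonal if and only if $$P=\begin{bmatrix}c_{00}&c_{01}&-\frac{\bar b_1}{\bar a_2}c_{01}&\frac{\bar b_1\bar b_2}{\bar a_2\bar a_3}c_{01}&\cdots\\ \bar c_{01}&c_{11}&c_{12}&-\frac{\bar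 b_2}{\bar a_3}c_{12}&\cdots\\ -\frac{b_1}{a_2}\bar c_{01}&\bar c_{12}&c_{22}&c_{23}&\cdots\\ \frac{b_1b_2}{a_2a_3}\bar c_{01}&-\frac{b_2}{a_3}\bar c_{12}&\bar c_{23}&c_{33}&\cdots\\ \vdots&\vdots&\vdots&\vdots&\ddots\end{bmatrix}.$$
   Context: $\mathbb{D}$ is the open unit disc. For a positive definite scalar kernel $k$ on $\mathbb{D}$, analytic in the first variable, $\mathcal{H}_k$ is its reproducing kernel Hilbert space of analytic functions on $\mathbb{D}$. A kernel $k(z,w)=\sum_{m,n\ge 0}C_{mn}z^m\bar w^n$ is tridiagonal if $C_{mn}=0$ whenever $|m-n|\ge 2$, and then $\mathcal{H}_k$ is called a tridiagonal space. ''Tridiagonal space corresponding to the orthonormal basis $\{f_n\}$'' means: $\{a_n\}_{n\ge 0}$, $\{b_n\}_{n\ge 0}$ are complex scalars with $a_n\ne 0$ for all $n$ (standing assumption), the functions $f_n(z)=(a_n+b_nz)z^n$ form an orthonormal basis of $\mathcal{H}_k$, and hence $k(z,w)=\sum_{n\ge 0}f_n(z)\overline{f_n(w)}$. *)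

(* Defs.v *)
From HB Require Import structures.
From mathcomp Require Import all_boot all_order all_algebra.
From mathcomp Require Import finmap.
From mathcomp Require Import complex.
From mathcomp Require Import boolp classical_sets reals topology normedtype derive.
From mathcomp.analysis.showcase Require Import summability.

Set Implicit Arguments.
Unset Strict Implicit.
Unset Printing Implicit Defensive.

Import Order.TTheory GRing.Theory Num.Theory Num.Def.
Import numFieldNormedType.Exports.

Local Open Scope classical_set_scope.
Local Open Scope ring_scope.
Local Open Scope complex_scope.

(* All functions "on the disc" are total functions on R[i]; only their values
   on [disc] are ever constrained or used. *)
Definition disc (R : realType) : set R[i] := [set z | `|z| < 1].

Definition analytic_on_disc (R : realType) (g : R[i] -> R[i]) : Prop :=
  forall z, disc z -> derivable (g : R[i]^o -> R[i]^o) z 1.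

(* "Positive definite" in the sense of reproducing kernels: all Gram forms are
   nonnegative (in the order of R[i], [0 <= x] says that x is real and >= 0). *)
Definition positive_definite (R : realType) (k : R[i] -> R[i] -> R[i]) : Prop :=
  forall (n : nat) (x : 'I_n -> R[i]) (t : 'I_n -> R[i]),
    (forall i, disc (x i)) ->
    0 <= \sum_(i < n) \sum_(j < n) conjC (t i) * t j * k (x i) (x j).

Record analytic_kernel (R : realType) (k : R[i] -> R[i] -> R[i]) : Prop := {
  analytic_kernel_posdef : positive_definite k;
  analytic_kernel_analytic :
    forall w, disc w -> analytic_on_disc (fun z => k z w) }.

(* The double power series is summed unconditionally, i.e. along the net of
   finite subsets of nat * nat; for scalars this is absolute convergence. *)
Definition tridiagonal_kernel (R : realType) (k : R[i] -> R[i] -> R[i]) : Prop :=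
  exists C : nat -> nat -> R[i],
    (forall m n : nat, (m.+2 <= n)%N || (n.+2 <= m)%N -> C m n = 0) /\
    (forall z w, disc z -> disc w ->
       partial_sum (fun p : nat * nat => C p.1 p.2 * z ^+ p.1 * conjC w ^+ p.2)
         @ totally --> (k z w : R[i]^o)).

(* [H], with evaluation [ev h z] = h(z), is the reproducing kernel Hilbert
   space of [k]; [kf w] is the element k(., w) of H.  Completeness is part of
   the type of [H]. *)
Record is_rkhs (R : realType) (H : completeNormedModType R[i])
    (ip : {dot H for conjC}) (ev : H -> R[i] -> R[i])
    (k : R[i] -> R[i] -> R[i]) (kf : R[i] -> H) : Prop := {
  rkhs_norm : forall h, `|h| ^+ 2 = ip h h;
  rkhs_ev_linear : forall (t : R[i]) (g h : H) z, disc z ->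
    ev (t *: g + h) z = t * ev g z + ev h z;
  rkhs_ev_inj : forall h, (forall z, disc z -> ev h z = 0) -> h = 0;
  rkhs_analytic : forall h, analytic_on_disc (ev h);
  rkhs_kernel : forall z w, disc z -> disc w -> ev (kf w) z = k z w;
  rkhs_reproducing : forall h w, disc w -> ev h w = ip h (kf w) }.

Record orthonormal_basis (R : realType) (H : completeNormedModType R[i])
    (ip : {dot H for conjC}) (f : nat -> H) : Prop := {
  onb_orthonormal : forall m n, ip (f m) (f n) = (m == n)%:R;
  onb_total : closure [set h | exists (N : nat) (t : nat -> R[i]),
                h = \sum_(i < N) t i *: f i] = setT }.

(* H is the tridiagonal space of k corresponding to the orthonormal basis
   f_n(z) = (a_n + b_n z) z^n. *)
Record tridiagonal_space (R : realType) (H : completeNormedModType R[i])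
    (ip : {dot H for conjC}) (ev : H -> R[i] -> R[i])
    (k : R[i] -> R[i] -> R[i]) (kf : R[i] -> H)
    (a b : nat -> R[i]) (f : nat -> H) : Prop := {
  tridiag_kernel : analytic_kernel k;
  tridiag_tridiagonal : tridiagonal_kernel k;
  tridiag_rkhs : is_rkhs ip ev k kf;
  tridiag_a_neq0 : forall n, a n != 0;
  tridiag_basis : orthonormal_basis ip f;
  tridiag_basisE :
    forall n z, disc z -> ev (f n) z = (a n + b n * z) * z ^+ n }.

Definition bounded_operator (R : realType) (H : completeNormedModType R[i])
    (P : {linear H -> H}) : Prop :=
  exists M : R, forall h, `|P h| <= M%:C * `|h|.

Definition positive_operator (R : realType) (H : completeNormedModType R[i])
    (ip : {dot H for conjC}) (P : {linear H -> H}) : Prop :=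
  forall h, 0 <= ip (P h) h.

Definition operator_matrix (R : realType) (H : completeNormedModType R[i])
    (ip : {dot H for conjC}) (f : nat -> H) (P : {linear H -> H})
    (m n : nat) : R[i] :=
  ip (P (f n)) (f m).

(* The Hermitian infinite matrix whose entries on and above the diagonal are
   the c m n; the c m n with n < m are not used. *)
Definition hermitian_extension (R : realType) (c : nat -> nat -> R[i])
    (m n : nat) : R[i] :=
  if (m <= n)%N then c m n else conjC (c n m).

Definition operator_kernel (R : realType) (H : completeNormedModType R[i])
    (ip : {dot H for conjC}) (kf : R[i] -> H) (P : {linear H -> H})
    (z w : R[i]) : R[i] :=
  ip (P (kf w)) (kf z).

Definition offdiag_coef (R : realType) (a b : nat -> R[i]) (m n : nat) : R[i] :=
  (-1) ^+ (n - m - 1) *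
  ((\prod_(m.+1 <= i < n) conjC (b i)) / \prod_(m.+2 <= i < n.+1) conjC (a i)).

Definition tridiagonal_matrix (R : realType) (a b : nat -> R[i])
    (c : nat -> nat -> R[i]) : nat -> nat -> R[i] :=
  hermitian_extension (fun m n =>
    if (n <= m.+1)%N then c m n else offdiag_coef a b m n * c m m.+1).

(* Main.v *)
Require Import Defs.
From mathcomp Require Import all_boot all_order all_algebra.
From mathcomp Require Import finmap.
From mathcomp Require Import complex boolp classical_sets reals topology.
From mathcomp Require Import normedtype sequences derive.
From mathcomp.analysis.showcase Require Import summability.
From mathcomp Require Import ring zify.
Set Implicit Arguments.
Unset Strict Implicit.
Unset Printing Implicit Defensive.
Import Order.TTheory GRing.Theory Num.Theory Num.Def.
Import numFieldNormedType.Exports.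
Local Open Scope ring_scope.
Local Open Scope complex_scope.

(** The kernel function at [w] expands in powers of [conjC w]: regrouping
    [k_w = \sum_n conjC (f_n w) *: f_n] by powers gives
    [k_w = \sum_n conjC w ^+ n *: kappa_n], where
    [kappa_n = conjC a_n *: f_n + conjC b_(n-1) *: f_(n-1)] ([kernel_coef]).
    Hence [K z w = <P k_w, k_z> = \sum_(m, n) C m n z^m (conjC w)^n] with
    [C m n = <P kappa_n, kappa_m>], and the theorem becomes a statement on
    the numbers [C m n].

    Analysis.  Each evaluation [h |-> h z] is bounded, so the numbers
    [f_n r] and [f_n (- r)] are bounded in [n] for every [0 < r < 1], and
    hence so are [a_n r^n] and [b_n r^(n+1)] ([coef_growth]).  Therefore the
    partial sums of [\sum_n conjC w ^+ n *: kappa_n] converge to [k_w] in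
    norm ([kernel_partial_cvg]), and [C m n] is bounded by a multiple of
    [r^-(m+n)] for every [r < 1].  The power series of [K] thus converges
    absolutely on the bidisc, with sum [K] ([operator_kernel_expansion]).
    The coefficients of an absolutely convergent double power series are
    unique ([double_series_eq0]), so [K] is tridiagonal exactly when
    [C m n = 0] for [|m - n| >= 2] ([tridiagonal_kernelP]).

    Algebra.  Since [P] is self-adjoint, only [n >= m + 2] matters.  With
    [u m n = <P kappa_n, f_m>] one has
    [C m n = a_m u m n + b_(m-1) u (m-1) n], and because [a_m != 0] an
    induction on [m] shows that [C] vanishes above the first superdiagonal
    exactly when [u] does.  Finally
    [u m n = conjC a_n * p m n + conjC b_(n-1) * p m (n-1)], where [p] is the
    matrix of [P], so [u m n = 0] is a first-order recurrence along row [m];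
    its solution started at [p m (m+1)] is the formula of the theorem
    ([operator_coef_tridiagonalP]). *)

(** * Absolutely convergent double sums *)

#[local] Existing Instance totally_filter.

Section Sums.
Variable R : realType.
Local Notation C := R[i].

Lemma expr_eventually_lt (q e : C) : 0 <= q -> q < 1 -> 0 < e ->
  exists N, forall n, (N <= n)%N -> q ^+ n < e.
Proof.
move=> q0 q1 e0.
have -> : q = (complex.Re q)%:C.
  by move: q0; rewrite lecE => /andP[/eqP/= i0 _]; case: q i0 {q1} => x y /= ->.
have eE : e = (complex.Re e)%:C.
  by move: e0; rewrite ltcE => /andP[/eqP/= i0 _]; case: e i0 => x y /= ->.
have r0 : 0 <= complex.Re q by move: q0; rewrite lecE => /andP[].
have r1 : complex.Re q < 1 by move: q1; rewrite ltcE => /andP[].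
have s0 : 0 < complex.Re e by move: e0; rewrite ltcE => /andP[].
have /cvgr0Pnorm_lt /(_ _ s0) [N _ NP] :
    (GRing.exp (complex.Re q) @ \oo --> (0 : R))%classic.
  by apply: cvg_expr; rewrite ger0_norm.
exists N => n Nn; have := NP n Nn; rewrite /= ger0_norm ?exprn_ge0// => h.
by rewrite eE -rmorphXn/= ltcR.
Qed.

Definition square_sum (F : nat -> nat -> C) N :=
  \sum_(0 <= m < N) \sum_(0 <= n < N) F m n.

Definition square N : {fset nat * nat} :=
  [fset p in [seq (m, n) | m <- index_iota 0 N, n <- index_iota 0 N]]%fset.

Lemma mem_square N p : (p \in square N) = (p.1 < N)%N && (p.2 < N)%N.
Proof.
rewrite inE /=; apply/allpairsP/idP.
  by case=> -[m n] /= []; rewrite !mem_index_iota /= => mN nN ->; rewrite mN.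
by case/andP=> h1 h2; exists p; rewrite !mem_index_iota; split=> //; case: (p).
Qed.

Lemma square_sumE F N : square_sum F N = \sum_(p <- square N) F p.1 p.2.
Proof.
transitivity (\sum_(p <- [seq (m, n) | m <- index_iota 0 N, n <- index_iota 0 N])
    F p.1 p.2); first by rewrite big_allpairs.
apply: perm_big; apply: uniq_perm.
- by apply: allpairs_uniq; rewrite ?iota_uniq// => -[? ?] [? ?].
- exact: fset_uniq.
- by move=> p; rewrite mem_square; rewrite -mem_square inE.
Qed.

Lemma fset_square (A : {fset nat * nat}) :
  exists N0, forall N, (N0 <= N)%N -> (A `<=` square N)%fset.
Proof.
exists (\max_(p <- A) maxn p.1 p.2).+1 => N leN; apply/fsubsetP => p pA.
have h : (maxn p.1 p.2 <= \max_(p <- A) maxn p.1 p.2)%N.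
  by rewrite (big_rem p pA) /= leq_maxl.
rewrite mem_square; lia.
Qed.

Lemma partial_sumE (F : nat * nat -> C) (A : {fset nat * nat}) :
  partial_sum F A = \sum_(p <- A) F p.
Proof. by rewrite /partial_sum big_seq_fsetE. Qed.

Lemma ler_sum_fsubset (F : nat * nat -> C) (A B : {fset nat * nat}) :
  (forall p, 0 <= F p) -> (A `<=` B)%fset ->
  \sum_(p <- A) F p <= \sum_(p <- B) F p.
Proof.
move=> F0 /fsubsetP AB.
rewrite -(big_rmcond_in (fun p => p \in A)) /=; last by move=> p pA /negP.
rewrite [leRHS](bigID (fun p => p \in A)) /=.
have -> : \sum_(i <- A | i \in A) F i = \sum_(i <- B | i \in A) F i.
  rewrite -[LHS]big_filter -[RHS]big_filter; apply: perm_big; apply: uniq_perm.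
  - by rewrite filter_uniq.
  - by rewrite filter_uniq.
  - by move=> p; rewrite !mem_filter andbb; case: (boolP (p \in A)) => // /AB ->.
by rewrite lerDl sumr_ge0.
Qed.

Lemma sum_geometric_le (q : C) N : 0 <= q -> q < 1 ->
  \sum_(0 <= m < N) q ^+ m <= (1 - q)^-1.
Proof.
move=> q0 q1; have q1' : 0 < 1 - q by rewrite subr_gt0.
rewrite -[leRHS]mul1r ler_pdivlMr// big_mkord mulrC -opprB mulNr -subrX1 opprB.
by rewrite gerBl exprn_ge0.
Qed.

Lemma sum_geometric2_le (q : C) (A : {fset nat * nat}) : 0 <= q -> q < 1 ->
  \sum_(p <- A) q ^+ (p.1 + p.2) <= (1 - q) ^- 2.
Proof.
move=> q0 q1; have [N /(_ N (leqnn N)) AN] := fset_square A.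
apply: (le_trans (@ler_sum_fsubset (fun p => q ^+ (p.1 + p.2)) _ _ _ AN)).
  by move=> p; rewrite exprn_ge0.
rewrite -(square_sumE (fun m n => q ^+ (m + n))) /square_sum.
under eq_bigr do under eq_bigr do rewrite exprD.
under eq_bigr do rewrite -mulr_sumr.
rewrite -mulr_suml -expr2 -exprVn; apply: lerXn2r; last exact: sum_geometric_le.
- by rewrite nnegrE sumr_ge0// => i _; rewrite exprn_ge0.
- by rewrite nnegrE invr_ge0 subr_ge0 ltW.
Qed.

Lemma cvg_totallyP (F : nat * nat -> C) (l : C) :
  (partial_sum F @ totally --> (l : C^o))%classic <->
  forall e : C, 0 < e -> exists A, forall B, (A `<=` B)%fset ->
    `|l - \sum_(p <- B) F p| < e.
Proof.
split.
  move=> /(@cvgrPdist_lt _ C^o _ _ _ (partial_sum F : _ -> C^o) (l : C^o)) h e e0.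
  have [A _ AP] := h e e0.
  by exists A => B AB; rewrite -partial_sumE; apply: AP.
move=> h; apply/(@cvgrPdist_lt _ C^o _ _ _ (partial_sum F : _ -> C^o) (l : C^o)) => e e0.
have [A AP] := h e e0.
by exists A => // B AB; rewrite /= partial_sumE; apply: AP.
Qed.

Definition square_cvg (F : nat -> nat -> C) (l : C) := forall e : C, 0 < e ->
  exists N0, forall N, (N0 <= N)%N -> `|l - square_sum F N| < e.

Lemma cvg_totally_square (F : nat -> nat -> C) (l : C) :
  (partial_sum (fun p => F p.1 p.2) @ totally --> (l : C^o))%classic ->
  square_cvg F l.
Proof.
move=> /cvg_totallyP h e /h[A AP]; have [N0 N0P] := fset_square A.
by exists N0 => N /N0P /AP; rewrite square_sumE.
Qed.

(** A single term is the difference of two partial sums that both contain a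
    finite set beyond which all partial sums are within 1 of the limit; the
    terms inside that finite set are bounded by their total. *)
Lemma cvg_totally_bounded (F : nat -> nat -> C) (l : C) :
  (partial_sum (fun p => F p.1 p.2) @ totally --> (l : C^o))%classic ->
  exists M, forall m n, `|F m n| <= M.
Proof.
move=> /cvg_totallyP/(_ 1 ltr01)[A AP].
have A0 : 0 <= \sum_(p <- A) `|F p.1 p.2| by apply: sumr_ge0 => p _.
exists (2 + \sum_(p <- A) `|F p.1 p.2|) => m n.
case: (boolP ((m, n) \in A)) => mnA.
  apply: (@le_trans _ _ (\sum_(p <- A) `|F p.1 p.2|)); last by rewrite lerDr.
  by rewrite (big_rem (m, n))//= lerDl sumr_ge0.
have := AP _ (fsubsetUr [fset (m, n)]%fset A).
rewrite big_fsetU1//= => h1; have h2 := AP _ (fsubset_refl A).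
apply: (@le_trans _ _ 2); last by rewrite lerDl.
set S := \sum_(p <- A) _ in h1 h2.
have -> : F m n = (l - S) - (l - (F m n + S)) by ring.
by apply: (le_trans (ler_normB _ _)); rewrite -[2]/(1 + 1) lerD// ltW.
Qed.

(** A geometric bound turns convergence along squares into unconditional
    convergence: outside the square of side [N] one of the exponents is at
    least [N], and splitting [q = s ^+ 2] leaves a factor [s ^+ N] in front
    of a sum that is bounded independently of the finite set. *)
Lemma square_cvg_totally (F : nat -> nat -> C) (l q M : C) :
  0 <= q -> q < 1 -> (forall m n, `|F m n| <= M * q ^+ (m + n)) ->
  square_cvg F l ->
  (partial_sum (fun p => F p.1 p.2) @ totally --> (l : C^o))%classic.
Proof.
move=> q0 q1 FM Fl; apply/cvg_totallyP => e e0.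
set s := sqrtC q; have s0 : 0 <= s by rewrite sqrtC_ge0.
have sq : s ^+ 2 = q by rewrite sqrtCK.
have s1 : s < 1 by rewrite -(@ltr_pXn2r _ 2) ?nnegrE// sq expr1n.
have M0 : 0 <= M by have := le_trans (normr_ge0 _) (FM 0%N 0%N); rewrite mulr1.
have e2 : 0 < e / 2 by rewrite divr_gt0.
have [N1 N1P] := Fl _ e2.
set B := M * (1 - s) ^- 2.
have B0 : 0 <= B by rewrite mulr_ge0// invr_ge0 exprn_ge0// subr_ge0 ltW.
have [N2 N2P] : exists N, forall n, (N <= n)%N -> s ^+ n < e / 2 / (B + 1).
  by apply: expr_eventually_lt; rewrite // divr_gt0// ltr_wpDl.
set N := maxn N1 N2; exists (square N) => A NA.
have -> : \sum_(p <- A) F p.1 p.2 =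
    square_sum F N + \sum_(p <- A | p \notin square N) F p.1 p.2.
  rewrite (bigID (fun p => p \in square N)) /= square_sumE; congr (_ + _).
  rewrite -big_filter; apply: perm_big; apply: uniq_perm.
  - exact/filter_uniq/fset_uniq.
  - exact: fset_uniq.
  - move=> p; rewrite mem_filter; case: (boolP (p \in square N)) => // pN.
    by have /fsubsetP/(_ _ pN) -> := NA.
rewrite opprD addrA [e](splitr e); apply: le_lt_trans (ler_normB _ _) _.
apply: ltr_leD; first by apply: N1P; rewrite leq_maxl.
apply: (@le_trans _ _ (s ^+ N * B)); last first.
  have := N2P N (leq_maxr _ _); rewrite ltr_pdivlMr ?ltr_wpDl// => h.
  apply: ltW; apply: le_lt_trans h; rewrite ler_wpM2l ?exprn_ge0//.
  by rewrite lerDl.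
apply: le_trans (ler_norm_sum _ _ _) _.
rewrite /B mulrCA.
apply: (@le_trans _ _ (\sum_(p <- A) M * (s ^+ N * s ^+ (p.1 + p.2)))); last first.
  by rewrite -!mulr_sumr; do 2!rewrite ler_wpM2l ?exprn_ge0//; apply: sum_geometric2_le.
rewrite big_mkcond; apply: ler_sum => -[m n] _ /=; case: ifP => pN; last first.
  by rewrite !mulr_ge0// exprn_ge0.
apply: le_trans (FM _ _) _; rewrite ler_wpM2l// -sq exprAC expr2.
rewrite ler_wpM2r ?exprn_ge0// ler_wiXn2l// ?ltW//.
by move: pN; rewrite mem_square /=; lia.
Qed.

End Sums.

(** * Uniqueness of double power series *)

Section Uniqueness.
Variable R : realType.
Local Notation C := R[i].

(** The lexicographically first nonzero coefficient vanishes.  On the curve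
    [z = t ^+ n.+1], [w = t] the lexicographic order of the monomials agrees,
    next to [(m, n)], with the order of the exponents of [t]: every later
    monomial has a strictly larger exponent.  So the coefficient is
    [O(t)] as [t] tends to 0. *)
Lemma double_series_term_eq0 (D : nat -> nat -> C) (M : C) (m n : nat) :
  (forall m n, `|D m n| <= M * 2 ^+ (m + n)) ->
  (forall z w : C, 0 < z < 1 -> 0 < w < 1 ->
     square_cvg (fun m n => D m n * z ^+ m * w ^+ n) 0) ->
  (forall m' n', (m' < m)%N || (m' == m) && (n' < n)%N -> D m' n' = 0) ->
  D m n = 0.
Proof.
move=> DM Dcvg Dlow.
have M0 : 0 <= M by have := le_trans (normr_ge0 _) (DM 0%N 0%N); rewrite mulr1.
pose e0 := (n.+1 * m + n)%N.
(* For [t <= 4^-1] and [e > e0], [t ^+ e <= t ^+ e0.+1 * (4 ^+ e0.+1 * 4^-1 ^+ e)];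
   the last factor of [K] bounds the double geometric series of ratio 1/2. *)
pose K := M * 4 ^+ e0.+1 * (1 - 2^-1) ^- 2.
have half0 : 0 <= 2^-1 :> C by rewrite invr_ge0.
have half1 : 2^-1 < 1 :> C by rewrite invf_lt1// ltr1n.
have K0 : 0 <= K by rewrite !mulr_ge0// ?exprn_ge0// invr_ge0 exprn_ge0// subr_ge0 ltW.
have key t : 0 < t -> t <= 4^-1 -> `|D m n| <= t * K.
  move=> t0 t4.
  have t1 : t < 1 by apply: le_lt_trans t4 _; rewrite invf_lt1// ltr1n.
  pose G (m' n' : nat) := D m' n' * (t ^+ n.+1) ^+ m' * t ^+ n'.
  have GE m' n' : G m' n' = D m' n' * t ^+ (n.+1 * m' + n').
    by rewrite /G -exprM exprD mulrA.
  have Gle p : p != (m, n) ->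
      `|G p.1 p.2| <= t ^+ e0.+1 * (M * 4 ^+ e0.+1) * 2^-1 ^+ (p.1 + p.2).
    case: p => m' n' /= pmn; rewrite GE.
    case: (boolP ((m' < m)%N || (m' == m) && (n' < n)%N)) => [/Dlow ->|hi].
      by rewrite mul0r normr0 !mulr_ge0// ?exprn_ge0// ltW.
    have he : (e0 < n.+1 * m' + n')%N.
      have [h|[-> h]] : (m < m')%N \/ (m' = m) /\ (n < n')%N.
      - by move: pmn hi; rewrite xpair_eqE; lia.
      - by rewrite /e0; nia.
      - by rewrite /e0 ltn_add2l.
    rewrite normrM normrX (gtr0_norm t0) -(subnK he) (exprD t).
    set e := (_ - _)%N; set s := (m' + n')%N.
    have es : (s <= e + e0.+1)%N by rewrite /e /s subnK//; nia.
    rewrite mulrA mulrC -!mulrA; apply: ler_wpM2l; first by rewrite exprn_ge0// ltW.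
    apply: le_trans (ler_wpM2r _ (DM m' n')) _; first by rewrite exprn_ge0// ltW.
    rewrite -mulrA; apply: ler_wpM2l => //.
    have te : t ^+ e <= 4^-1 ^+ e by apply: lerXn2r; rewrite ?nnegrE ?invr_ge0// ltW.
    apply: le_trans (ler_wpM2l _ te) _; first by rewrite exprn_ge0.
    have -> : 4^-1 ^+ e = 4 ^+ e0.+1 * 4^-1 ^+ (e + e0.+1) :> C.
      by rewrite exprD mulrCA -exprMn divff ?expr1n ?mulr1// pnatr_eq0.
    rewrite mulrCA; apply: ler_wpM2l; first by rewrite exprn_ge0.
    apply: le_trans (_ : 2 ^+ s * 4^-1 ^+ s <= _).
      apply: ler_wpM2l; first by rewrite exprn_ge0.
      by rewrite ler_wiXn2l// ?invr_ge0// invf_le1// ler1n.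
    by rewrite -exprMn (_ : 2 * 4^-1 = 2^-1 :> C)//; field.
  have te0 : 0 < t ^+ e0 by rewrite exprn_gt0.
  rewrite -(ler_pM2r te0).
  apply/ler_addgt0Pr => e egt0.
  have zz : 0 < t ^+ n.+1 < 1 by rewrite exprn_gt0// exprn_ilt1// ltW.
  have [N0 N0P] := Dcvg _ _ zz (introT andP (conj t0 t1)) e egt0.
  pose N := (N0 + (m + n).+1)%N.
  have := N0P N (leq_addr _ _); rewrite sub0r normrN square_sumE -/(G).
  have mnN : (m, n) \in square N by rewrite mem_square /= /N; lia.
  rewrite (big_rem _ mnN) /= => /ltW hS.
  set S := (\sum_(p <- _) _) in hS.
  have SK : `|S| <= t * K * t ^+ e0.
    apply: le_trans (ler_norm_sum _ _ _) _.
    rewrite (_ : t * K * _ = t ^+ e0.+1 * (M * 4 ^+ e0.+1) * (1 - 2^-1) ^- 2).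
      apply: le_trans (_ : _ <= \sum_(p <- rem (m, n) (square N))
        (t ^+ e0.+1 * (M * 4 ^+ e0.+1)) * 2^-1 ^+ (p.1 + p.2)) _.
        rewrite big_seq [leRHS]big_seq; apply: ler_sum => p.
        by rewrite mem_rem_uniq ?fset_uniq// inE => /andP[pmn _]; apply: Gle.
      rewrite -mulr_sumr; apply: ler_wpM2l; first by rewrite !mulr_ge0// ?exprn_ge0// ltW.
      apply: le_trans (sum_geometric2_le (square N) half0 half1).
      by rewrite [leRHS](big_rem _ mnN)/= lerDr exprn_ge0.
    by rewrite /K (exprS t); move: ((1 - 2^-1) ^- 2) (4 ^+ e0.+1) => h h'; ring.
  have : `|G m n| <= e + t * K * t ^+ e0.
    have -> : G m n = (G m n + S) - S by rewrite addrK.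
    by apply: le_trans (ler_normB _ _) _; apply: lerD.
  by rewrite GE -/e0 normrM (gtr0_norm te0) addrC.
apply/eqP; apply/negPn/negP => Dn0.
have x0 : 0 < `|D m n| by rewrite normr_gt0.
set x := `|D m n| in x0 key.
have xK : 0 < x + K by rewrite ltr_wpDr.
(* This [t] makes [t * K < x]. *)
have h : x <= 4^-1 * (x / (x + K)) * K.
  apply: key; first by rewrite mulr_gt0 ?invr_gt0// divr_gt0.
  by rewrite ler_piMr ?invr_ge0// ler_pdivrMr// mul1r lerDl.
have : x * (x + K) < x * (x + K).
  apply: (@le_lt_trans _ _ (4^-1 * (x * K))).
    rewrite -(ler_pM2r xK) in h; apply: le_trans h _.
    by rewrite mulrAC -[_ * (x + K)]mulrA divfK ?gt_eqF// -mulrA.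
  apply: (@le_lt_trans _ _ (x * K)); last by rewrite ltr_pM2l// ltrDr.
  by apply: ler_piMl; [rewrite mulr_ge0 ?(ltW x0)|rewrite invf_le1 ?ler1n].
by rewrite ltxx.
Qed.

Lemma double_series_eq0 (D : nat -> nat -> C) (M : C) :
  (forall m n, `|D m n| <= M * 2 ^+ (m + n)) ->
  (forall z w : C, 0 < z < 1 -> 0 < w < 1 ->
     square_cvg (fun m n => D m n * z ^+ m * w ^+ n) 0) ->
  forall m n, D m n = 0.
Proof.
move=> DM Dcvg; elim/ltn_ind => m IHm; elim/ltn_ind => n IHn.
apply: (double_series_term_eq0 DM Dcvg) => m' n' /orP[/IHm|/andP[/eqP-> /IHn]] //.
Qed.

Lemma square_cvgB (F G : nat -> nat -> C) (l l' : C) :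
  square_cvg F l -> square_cvg G l' ->
  square_cvg (fun m n => F m n - G m n) (l - l').
Proof.
move=> Fl Gl e e0; have e2 : 0 < e / 2 by rewrite divr_gt0.
have [N1 h1] := Fl _ e2; have [N2 h2] := Gl _ e2.
exists (maxn N1 N2) => N; rewrite geq_max => /andP[/h1 {}h1 /h2 {}h2].
have -> : square_sum (fun m n => F m n - G m n) N = square_sum F N - square_sum G N.
  by rewrite /square_sum -sumrB; apply: eq_bigr => i _; rewrite sumrB.
rewrite [e]splitr (_ : l - l' - _ = (l - square_sum F N) - (l' - square_sum G N)).
  by apply: le_lt_trans (ler_normB _ _) _; apply: ltrD.
by ring.
Qed.

Lemma eq_square_cvg (F G : nat -> nat -> C) (l : C) :
  (forall m n, F m n = G m n) -> square_cvg F l -> square_cvg G l.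
Proof.
move=> FG Fl e /Fl[N0 h]; exists N0 => N /h.
by rewrite /square_sum; under eq_bigr do under eq_bigr do rewrite FG.
Qed.

(** If some tridiagonal expansion of [K] exists, it is the expansion with
    coefficients [c], by uniqueness; this is why the quantified coefficients
    in the definition of a tridiagonal kernel can be replaced by [c]. *)
Lemma tridiagonal_kernelP (K : C -> C -> C) (c : nat -> nat -> C) :
  (forall r : C, 0 < r < 1 ->
     exists M, forall m n, `|c m n| * r ^+ (m + n) <= M) ->
  (forall z w, disc z -> disc w ->
     square_cvg (fun m n => c m n * z ^+ m * conjC w ^+ n) (K z w)) ->
  tridiagonal_kernel K <->
  forall m n : nat, (m.+2 <= n)%N || (n.+2 <= m)%N -> c m n = 0.
Proof.
move=> cM cK; split=> [[c' [c'0 c'K]] m n mn|c0].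
  suff /(_ m n)/eqP : forall m n, c' m n - c m n = 0.
    by rewrite subr_eq0 => /eqP <-; apply: c'0.
  have half0 : 0 < 2^-1 :> C by rewrite invr_gt0.
  have half1 : 2^-1 < 1 :> C by rewrite invf_lt1// ltr1n.
  have [M1 hM1] := cM 2^-1 (introT andP (conj half0 half1)).
  have dr (x : C) : 0 < x < 1 -> disc x.
    by case/andP=> x0 x1; rewrite /disc /mkset gtr0_norm.
  have dhalf := dr _ (introT andP (conj half0 half1)).
  have [M2 hM2] := cvg_totally_bounded
    (F := fun m n => c' m n * 2^-1 ^+ m * conjC 2^-1 ^+ n) (c'K _ _ dhalf dhalf).
  apply: (@double_series_eq0 _ (M1 + M2)) => [i j|z w z01 w01].
    have le2 x M : x * 2^-1 ^+ (i + j) <= M -> x <= M * 2 ^+ (i + j) :> C.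
      by rewrite exprVn ler_pdivrMr ?exprn_gt0//.
    apply: le_trans (ler_normB _ _) _; rewrite addrC mulrDl lerD//.
      exact/le2/hM1.
    apply: le2; have := hM2 i j.
    rewrite !normrM !normrX norm_conjC !(gtr0_norm half0) -mulrA -exprD.
    by [].
  have wc : conjC w = w by apply/CrealP/gtr0_real; case/andP: w01.
  have h1 := cvg_totally_square
    (F := fun m n => c' m n * z ^+ m * conjC w ^+ n) (c'K _ _ (dr _ z01) (dr _ w01)).
  have h2 := square_cvgB h1 (cK _ _ (dr _ z01) (dr _ w01)).
  rewrite subrr in h2; apply: eq_square_cvg h2 => i j.
  by rewrite wc; ring.
exists c; split=> // z w hz hw.
have z0 := normr_ge0 z; have w0 := normr_ge0 w.
(* A common bound of [|z|] and [|w|] below 1, polynomial in both because the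
   order of [C] is only partial. *)
pose q := 1 - (1 - `|z|) * (1 - `|w|).
have q1 : q < 1 by rewrite /q gtrBl mulr_gt0 ?subr_gt0.
have zq : `|z| <= q.
  have -> : q = `|z| + (1 - `|z|) * `|w| by rewrite /q; ring.
  by rewrite lerDl mulr_ge0 ?subr_ge0// ltW.
have wq : `|w| <= q.
  have -> : q = `|w| + (1 - `|w|) * `|z| by rewrite /q; ring.
  by rewrite lerDl mulr_ge0 ?subr_ge0// ltW.
have q0 : 0 <= q by apply: le_trans zq.
pose r := (1 + q) / 2.
have r0 : 0 < r by rewrite divr_gt0// ltr_wpDr.
have r1 : r < 1 by rewrite ltr_pdivrMr// mul1r ltrD2l.
have qr : q < r by rewrite ltr_pdivlMr// mulr_natr mulr2n ltrD2r.
have [M hM] := cM r (introT andP (conj r0 r1)).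
apply: (@square_cvg_totally _ (fun m n => c m n * z ^+ m * conjC w ^+ n) _ (q / r) M).
- by rewrite divr_ge0// ltW.
- by rewrite ltr_pdivrMr// mul1r.
- move=> m n; rewrite !normrM !normrX norm_conjC.
  apply: (@le_trans _ _ (`|c m n| * r ^+ (m + n) * (q / r) ^+ (m + n))); last first.
    by rewrite ler_wpM2r ?hM// exprn_ge0// divr_ge0// ltW.
  rewrite -[X in _ <= X]mulrA -exprMn [r * _]mulrC divfK ?gt_eqF// -mulrA.
  by rewrite ler_wpM2l// exprD ler_pM ?exprn_ge0// lerXn2r.
- exact: cK.
Qed.
End Uniqueness.

(** * Fourier sums in a Hilbert space *)

Section Hilbert.
Variables (R : realType) (H : completeNormedModType R[i]).
Variable ip : {dot H for conjC}.
Local Notation C := R[i].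
Hypothesis ip_norm : forall h, `|h| ^+ 2 = ip h h.

Lemma ipC u v : ip u v = conjC (ip v u).
Proof. by rewrite hermC expr0 mul1r. Qed.

Lemma ipZl t u v : ip (t *: u) v = t * ip u v.
Proof. exact: linearZl_LR. Qed.

Lemma ipZr t u v : ip u (t *: v) = conjC t * ip u v.
Proof. exact: linearZr_LR. Qed.

Lemma ipDl u v x : ip (u + v) x = ip u x + ip v x.
Proof. exact: linearDl. Qed.

Lemma ipDr u v x : ip x (u + v) = ip x u + ip x v.
Proof. exact: linearDr. Qed.

Lemma ip_suml (I : Type) (r : seq I) (F : I -> H) v :
  ip (\sum_(i <- r) F i) v = \sum_(i <- r) ip (F i) v.
Proof. exact: linear_sumlz. Qed.

Lemma ip_sumr (I : Type) (r : seq I) (F : I -> H) v :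
  ip v (\sum_(i <- r) F i) = \sum_(i <- r) ip v (F i).
Proof. exact: linear_sumr. Qed.

(** Pythagoras for [u] minus its projection on [v]; the form is used here on
    a space of arbitrary dimension. *)
Lemma cauchy_schwarz u v : `|ip u v| <= `|u| * `|v|.
Proof.
have [->|v0] := eqVneq v 0; first by rewrite linear0r !normr0 mulr0.
have nv : 0 < `|v| by rewrite normr_gt0.
set d := ip u v; set t := d / `|v| ^+ 2.
have xv : ip (u - t *: v) v = 0.
  by rewrite linearBl linearZl_LR /= -ip_norm /t divfK ?subrr// expf_neq0 ?gt_eqF.
have : 0 <= `|u - t *: v| ^+ 2 by rewrite exprn_ge0.
rewrite ip_norm linearBr linearZr_LR /= xv mulr0 subr0.
rewrite linearBl linearZl_LR /= -ip_norm (ipC v u) -/d subr_ge0.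
rewrite /t mulrAC -normCK ler_pdivrMr ?exprn_gt0// -exprMn => h.
by rewrite -(@ler_pXn2r _ 2) ?nnegrE ?mulr_ge0.
Qed.

Variable f : nat -> H.
Hypothesis f_onb : orthonormal_basis ip f.

Definition fourier_sum (h : H) N := \sum_(0 <= n < N) ip h (f n) *: f n.

Lemma ip_fourier_rest h N j : (j < N)%N -> ip (h - fourier_sum h N) (f j) = 0.
Proof.
move=> jN; rewrite linearBl linear_sumlz /=.
rewrite (bigD1_seq j) ?mem_index_iota ?iota_uniq//= big1 => [|i ij].
  by rewrite linearZl_LR /= (onb_orthonormal f_onb) eqxx mulr1 addr0 subrr.
by rewrite linearZl_LR /= (onb_orthonormal f_onb) (negPf ij) mulr0.
Qed.

(** [h - fourier_sum h N] is orthogonal to the span of the first [N] basis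
    vectors, so by Pythagoras no element of that span is closer to [h]. *)
Lemma fourier_best h N N0 (t : nat -> C) : (N0 <= N)%N ->
  `|h - fourier_sum h N| <= `|h - \sum_(i < N0) t i *: f i|.
Proof.
move=> N0N; set x := h - _; pose y := fourier_sum h N - \sum_(i < N0) t i *: f i.
have xy : ip x y = 0.
  rewrite linearBr !linear_sumr /= big_nat !big1 ?subrr// => i iN.
    by rewrite linearZr_LR /= ip_fourier_rest ?mulr0// (leq_trans _ N0N).
  by rewrite linearZr_LR /= ip_fourier_rest ?mulr0.
rewrite -(@ler_pXn2r _ 2) ?nnegrE// !ip_norm.
have -> : h - \sum_(i < N0) t i *: f i = x + y by rewrite /x /y addrA subrK.
by rewrite (hnormDd xy) lerDl; exact: dnorm_ge0.
Qed.

Lemma fourier_cvg h (e : C) : 0 < e ->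
  exists N0, forall N, (N0 <= N)%N -> `|h - fourier_sum h N| < e.
Proof.
move=> e0.
have : (closure [set h | exists N (t : nat -> C), h = \sum_(i < N) t i *: f i] h)%classic.
  by rewrite (onb_total f_onb).
move=> /(_ _ (nbhsx_ballx h _ e0))[_ [[N0 [t ->]]]].
rewrite -ball_normE /= => ht; exists N0 => N N0N.
exact: le_lt_trans (fourier_best h t N0N) ht.
Qed.

End Hilbert.

(** * Power series of the operator kernel *)

Section Tridiagonal.
Variables (R : realType) (H : completeNormedModType R[i]).
Variables (ip : {dot H for conjC}) (ev : H -> R[i] -> R[i]).
Variables (k : R[i] -> R[i] -> R[i]) (kf : R[i] -> H).
Variables (a b : nat -> R[i]) (f : nat -> H).
Hypothesis hH : tridiagonal_space ip ev k kf a b f.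
Local Notation C := R[i].

Let ip_norm h : `|h| ^+ 2 = ip h h.
Proof. exact: rkhs_norm (tridiag_rkhs hH) h. Qed.

Let f_onb : orthonormal_basis ip f := tridiag_basis hH.

Lemma norm_basis n : `|f n| = 1.
Proof.
apply/eqP; rewrite -(@eqrXn2 _ 2)// ip_norm (onb_orthonormal f_onb) eqxx.
by rewrite expr1n.
Qed.

Lemma basis_le n z : disc z -> `|(a n + b n * z) * z ^+ n| <= `|kf z|.
Proof.
move=> hz; rewrite -(tridiag_basisE hH)// (rkhs_reproducing (tridiag_rkhs hH))//.
by apply: le_trans (cauchy_schwarz ip_norm _ _) _; rewrite norm_basis mul1r.
Qed.

(** Adding and subtracting the bounds of [basis_le] at [r] and [- r] separates
    [a n] from [b n]. *)
Lemma coef_growth (r : C) : 0 < r < 1 ->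
  exists M, forall n, `|a n| * r ^+ n <= M /\ `|b n| * r ^+ n.+1 <= M.
Proof.
case/andP=> r0 r1; have dr : disc r by rewrite /disc /mkset gtr0_norm.
have dNr : disc (- r) by rewrite /disc /mkset normrN gtr0_norm.
have h n : `|a n + b n * r| * r ^+ n <= `|kf r|.
  by have := basis_le n dr; rewrite normrM normrX (gtr0_norm r0).
have h' n : `|a n - b n * r| * r ^+ n <= `|kf (- r)|.
  by have := basis_le n dNr; rewrite normrM normrX normrN (gtr0_norm r0) mulrN.
have half (x y : C) n : `|x + y| * r ^+ n <= `|kf r| ->
    `|x - y| * r ^+ n <= `|kf (- r)| -> `|x| * r ^+ n <= `|kf r| + `|kf (- r)|.
  move=> h1 h2; have := lerD h1 h2; rewrite -mulrDl; apply: le_trans.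
  rewrite ler_wpM2r ?exprn_ge0 ?(ltW r0)//.
  apply: le_trans (ler_normD _ _).
  have -> : x + y + (x - y) = x *+ 2 by ring.
  by rewrite normrMn mulr2n lerDl.
exists (`|kf r| + `|kf (- r)|) => n; split; first exact: half (h n) (h' n).
have -> : `|b n| * r ^+ n.+1 = `|b n * r| * r ^+ n.
  by rewrite normrM (gtr0_norm r0) exprS mulrA.
by apply: half; [rewrite addrC|rewrite distrC].
Qed.

(** The coefficient of [conjC w ^+ n] in the kernel function at [w];
    equivalently, the vector representing the [n]-th Taylor coefficient at 0. *)
Definition kernel_coef n : H :=
  conjC (a n) *: f n + (if n is n'.+1 then conjC (b n') *: f n' else 0).

Lemma kernel_coef_growth (r : C) : 0 < r < 1 ->
  exists2 M, 0 <= M & forall n, `|kernel_coef n| * r ^+ n <= M.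
Proof.
move=> r01; have [M hM] := coef_growth r01; case/andP: r01 => r0 r1.
have M0 : 0 <= M.
  by apply: le_trans (proj1 (hM 0%N)); rewrite mulr_ge0// exprn_ge0// ltW.
exists (M + M) => [|n]; first exact: addr_ge0.
have rn : 0 <= r ^+ n by rewrite exprn_ge0// ltW.
apply: le_trans (ler_wpM2r rn (ler_normD _ _)) _.
rewrite mulrDl normrZ norm_basis mulr1 norm_conjC lerD//; first by case: (hM n).
case: n {rn} => [|n]; first by rewrite normr0 mul0r.
by rewrite normrZ norm_basis mulr1 norm_conjC; case: (hM n).
Qed.

Definition kernel_partial w N := \sum_(0 <= n < N) conjC w ^+ n *: kernel_coef n.

(** The two ways of cutting the series of the kernel function, by powers or
    by basis vectors, differ only in one boundary term. *)
Lemma kernel_partialS w N : disc w -> kernel_partial w N.+1 =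
  fourier_sum ip f (kf w) N + (conjC w ^+ N * conjC (a N)) *: f N.
Proof.
move=> hw; elim: N => [|N IHN].
  rewrite /kernel_partial /fourier_sum big_nat1 big_nil add0r expr0 scale1r mul1r.
  by rewrite /kernel_coef addr0.
rewrite /kernel_partial big_nat_recr//= -/(kernel_partial w N.+1) IHN.
rewrite /fourier_sum big_nat_recr//= -!addrA; congr (_ + _).
rewrite (ipC ip (kf w)) -(rkhs_reproducing (tridiag_rkhs hH))// (tridiag_basisE hH)//.
rewrite scalerDr !scalerA [X in _ = X]addrC addrCA; congr (_ + _).
rewrite -scalerDl; congr (_ *: _).
rewrite rmorphM rmorphD rmorphM rmorphXn exprS /=; ring.
Qed.

(** The boundary term of [kernel_partialS] is at most [M (|w| / r)^N] for any
    radius [r] between [|w|] and 1. *)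
Lemma kernel_partial_cvg w (e : C) : disc w -> 0 < e ->
  exists N0, forall N, (N0 <= N)%N -> `|kf w - kernel_partial w N| < e.
Proof.
move=> hw e0; have e2 : 0 < e / 2 by rewrite divr_gt0.
have [N1 h1] := fourier_cvg ip_norm f_onb (kf w) e2.
pose r := (1 + `|w|) / 2.
have w1 : `|w| < 1 := hw.
have r0 : 0 < r by rewrite divr_gt0// ltr_wpDr.
have r1 : r < 1 by rewrite ltr_pdivrMr// mul1r ltrD2l.
have wr : `|w| < r by rewrite ltr_pdivlMr// mulr_natr mulr2n ltrD2r.
have [M hM] := coef_growth (introT andP (conj r0 r1)).
have M0 : 0 <= M.
  by apply: le_trans (proj1 (hM 0%N)); rewrite mulr_ge0// exprn_ge0// ltW.
have [N2 h2] : exists N, forall n, (N <= n)%N -> (`|w| / r) ^+ n < e / 2 / (M + 1).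
  apply: expr_eventually_lt; first by rewrite divr_ge0// ltW.
  - by rewrite ltr_pdivrMr// mul1r.
  - by rewrite divr_gt0// ltr_wpDl.
exists (maxn N1 N2).+1 => -[//|N]; rewrite ltnS geq_max => /andP[/h1 {}h1 /h2 {}h2].
rewrite kernel_partialS// opprD addrA [e]splitr.
apply: le_lt_trans (ler_normB _ _) _; apply: ltrD => //.
rewrite normrZ norm_basis mulr1 normrM normrX !norm_conjC.
rewrite ltr_pdivlMr ?ltr_wpDl// in h2; apply: le_lt_trans h2.
have -> : `|w| ^+ N = (`|w| / r) ^+ N * r ^+ N by rewrite -exprMn divfK ?gt_eqF.
have q0 : 0 <= `|w| / r by rewrite mulr_ge0 ?invr_ge0 ?(ltW r0).
rewrite -mulrA ler_wpM2l ?exprn_ge0// mulrC.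
by apply: le_trans (proj1 (hM N)) _; rewrite lerDl.
Qed.

Variable P : {linear H -> H}.
Hypothesis P_bounded : bounded_operator P.

Definition operator_coef m n := ip (P (kernel_coef n)) (kernel_coef m).

Lemma bounded_operator_ge0 : exists2 M : C, 0 <= M & forall h, `|P h| <= M * `|h|.
Proof.
have [M hM] := P_bounded; exists `|M%:C| => // h.
apply: le_trans (hM h) _; rewrite ler_wpM2r// real_ler_norm//.
by rewrite complex_real.
Qed.

Lemma operator_coef_growth (r : C) : 0 < r < 1 ->
  exists M, forall m n, `|operator_coef m n| * r ^+ (m + n) <= M.
Proof.
move=> r01; have [M M0 hM] := kernel_coef_growth r01.
have [B B0 hB] := bounded_operator_ge0.
have r0 : 0 <= r by case/andP: r01 => /ltW.
exists (B * M * M) => m n.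
apply: (@le_trans _ _ (B * (`|kernel_coef n| * r ^+ n) * (`|kernel_coef m| * r ^+ m))).
  rewrite exprD (_ : B * _ * _ =
    (B * `|kernel_coef n| * `|kernel_coef m|) * (r ^+ m * r ^+ n)); last by ring.
  rewrite ler_wpM2r ?mulr_ge0 ?exprn_ge0//.
  apply: le_trans (cauchy_schwarz ip_norm _ _) _.
  by rewrite ler_wpM2r.
by apply: ler_pM; rewrite ?mulr_ge0 ?exprn_ge0// ler_wpM2l.
Qed.

Lemma square_sum_operator_coef z w N :
  square_sum (fun m n => operator_coef m n * z ^+ m * conjC w ^+ n) N =
  ip (P (kernel_partial w N)) (kernel_partial z N).
Proof.
rewrite /kernel_partial ip_sumr; apply: eq_bigr => m _.
rewrite linear_sum ip_suml; apply: eq_bigr => n _.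
rewrite ipZr [P _]linearZ ipZl -/(operator_coef m n) rmorphXn /= conjCK.
by rewrite [RHS]mulrA [RHS]mulrC mulrA.
Qed.

Lemma operator_kernel_expansion z w : disc z -> disc w ->
  square_cvg (fun m n => operator_coef m n * z ^+ m * conjC w ^+ n)
    (operator_kernel ip kf P z w).
Proof.
move=> hz hw e e0; have [B B0 hB] := bounded_operator_ge0.
pose M := B * (`|kf z| + `|kf w| + 1).
have M0 : 0 <= M by rewrite mulr_ge0// !addr_ge0.
pose d := e / (e + M + 1).
have eM : 0 < e + M + 1 by rewrite ltr_wpDl// addr_ge0// ltW.
have d0 : 0 < d by rewrite divr_gt0.
have d1 : d <= 1.
  by rewrite ler_pdivrMr// mul1r -addrA lerDl addr_ge0.
have dM : d * M < e.
  rewrite mulrAC ltr_pdivrMr// ltr_pM2l//.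
  by rewrite addrAC addrC ltrDl addr_gt0.
have [N1 h1] := kernel_partial_cvg hz d0; have [N2 h2] := kernel_partial_cvg hw d0.
exists (maxn N1 N2) => N; rewrite geq_max => /andP[/h1 /ltW {}h1 /h2 /ltW {}h2].
rewrite square_sum_operator_coef /operator_kernel; apply: le_lt_trans dM.
set kz := kernel_partial z N in h1 *; set kw := kernel_partial w N in h2 *.
have -> : ip (P (kf w)) (kf z) - ip (P kw) kz =
    ip (P (kf w - kw)) (kf z) + ip (P kw) (kf z - kz).
  by rewrite !linearB linearBl /= addrA subrK.
have kwM : `|kw| <= `|kf w| + 1.
  rewrite -[kw](subKr (kf w)); apply: le_trans (ler_normB _ _) _.
  by rewrite lerD2l (le_trans h2).
have -> : d * M = B * d * `|kf z| + B * (`|kf w| + 1) * d by rewrite /M; ring.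
apply: le_trans (ler_normD _ _) _; apply: lerD.
  apply: le_trans (cauchy_schwarz ip_norm _ _) _; apply: ler_wpM2r => //.
  by apply: le_trans (hB _) _; rewrite ler_wpM2l.
apply: le_trans (cauchy_schwarz ip_norm _ _) _; apply: ler_pM => //.
by apply: le_trans (hB _) _; rewrite ler_wpM2l.
Qed.

(** [K (., w)] is the function represented by [P (kf w)], but only on the disc;
    differentiability at a point of the disc is a local property. *)
Lemma operator_kernel_analytic : positive_operator ip P ->
  analytic_kernel (operator_kernel ip kf P).
Proof.
move=> Ppos; split=> [n x t hx|w hw z hz].
  have := Ppos (\sum_(j < n) t j *: kf (x j)).
  rewrite ip_sumr; congr (0 <= _); apply: eq_bigr => i _.
  rewrite linear_sum ip_suml; apply: eq_bigr => j _.
  by rewrite ipZr [P _]linearZ ipZl mulrA.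
have hd : {near (z : C^o), (ev (P (kf w)) : C^o -> C^o) =1
    (fun y => operator_kernel ip kf P y w)}.
  apply/nbhs_ballP; exists (1 - `|z|); first by rewrite /= subr_gt0.
  move=> y; rewrite -ball_normE /= => yz.
  rewrite /operator_kernel -(rkhs_reproducing (tridiag_rkhs hH))//.
  rewrite /disc /mkset -(subKr z y); apply: le_lt_trans (ler_normB _ _) _.
  by rewrite -ltrBrDl.
exact: near_eq_derivable hd (rkhs_analytic (tridiag_rkhs hH) hz).
Qed.

End Tridiagonal.

(** * Recurrence along the rows of the matrix *)

Lemma offdiag_coef1 (R : realType) (a b : nat -> R[i]) m :
  offdiag_coef a b m m.+1 = 1.
Proof. by rewrite /offdiag_coef !big_geq// -addn1 addKn subnn expr0 invr1 !mulr1. Qed.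

Lemma offdiag_coefS (R : realType) (a b : nat -> R[i]) m n : (m < n)%N ->
  offdiag_coef a b m n.+1 = - (conjC (b n) / conjC (a n.+1)) * offdiag_coef a b m n.
Proof.
move=> mn; rewrite /offdiag_coef big_nat_recr//= [X in _ / X]big_nat_recr//=.
have -> : (n.+1 - m - 1 = (n - m - 1).+1)%N by lia.
rewrite exprS invfM; set x := \prod_(_ <= i < _) _; set y := (\prod_(_ <= i < _) _)^-1.
by move: x y (_ ^+ _) (conjC (b n)) (_^-1) => x y s b' a'; ring.
Qed.

Section Matrix.
Variables (R : realType) (H : completeNormedModType R[i]).
Variables (ip : {dot H for conjC}) (P : {linear H -> H}).
Hypothesis P_positive : positive_operator ip P.
Local Notation C := R[i].

(** Polarization: [<P x, x>] is real for [x = u + v] and for [x = u + 'i v]. *)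
Lemma positive_operator_hermitian u v : ip (P u) v = conjC (ip (P v) u).
Proof.
have real x : conjC (ip (P x) x) = ip (P x) x by apply/CrealP/ger0_real/P_positive.
have h1 := real (u + v); have h2 := real (u + 'i *: v).
move: h1 h2; rewrite !ipDr !ipZr !linearD !ipDl [P (_ *: _)]linearZ !ipZl.
rewrite !rmorphD !rmorphM /= !real conjCK.
move: (real v).
move: (ip (P u) v) (ip (P v) u) (ip (P u) u) (ip (P v) v) => x y s t tr.
rewrite rmorphD rmorphM /= tr conjCi.
move: (conjC x) (conjC y) => x' y' h1 h2.
have {}h1 : x' + y' = x + y.
  have -> : x' + y' = (s + y' + (x' + t)) - s - t by ring.
  by rewrite h1; ring.
have {}h2 : x' - y' = y - x.
  apply: (@mulfI _ 'i); first exact: neq0Ci.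
  have -> : 'i * (x' - y') =
    s + - 'i * y' + 'i * (x' + - 'i * t) - s + 'i * 'i * t by ring.
  by rewrite h2; ring.
apply: (@mulIf _ 2); first by rewrite pnatr_eq0.
have -> : y' * 2 = (x' + y') - (x' - y') by ring.
by rewrite h1 h2; ring.
Qed.


Variables (a b : nat -> C) (f : nat -> H).
Hypothesis a_neq0 : forall n, a n != 0.
Let p := operator_matrix ip f P.
Let c := operator_coef ip a b f P.

Let u m n := ip (P (kernel_coef a b f n)) (f m).

Let uS m n : u m n.+1 = conjC (a n.+1) * p m n.+1 + conjC (b n) * p m n.
Proof. by rewrite /u /= linearD ipDl ![P (_ *: _)]linearZ !ipZl. Qed.

Let c0E n : c 0 n = a 0%N * u 0%N n.
Proof. by rewrite /c /operator_coef /= [X in ip _ X]addr0 ipZr conjCK. Qed.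

Let cSE m n : c m.+1 n = a m.+1 * u m.+1 n + b m * u m n.
Proof. by rewrite /c /operator_coef /= ipDr !ipZr !conjCK. Qed.

Let u_eq0 : (forall m n, (m.+2 <= n)%N || (n.+2 <= m)%N -> c m n = 0) <->
  (forall m n, (m.+2 <= n)%N -> u m n = 0).
Proof.
split=> h m n.
  elim: m n => [|m IHm] n mn; apply/eqP; have /eqP := h _ n (introT orP (or_introl mn)).
    by rewrite c0E mulf_eq0 (negPf (a_neq0 _)).
  by rewrite cSE IHm 1?ltnW// mulr0 addr0 mulf_eq0 (negPf (a_neq0 _)).
have up i j : (i.+2 <= j)%N -> c i j = 0.
  case: i => [|i] ij; first by rewrite c0E h// mulr0.
  by rewrite cSE !h ?mulr0 ?addr0// ltnW.
case/orP=> [/up //|/up]; rewrite /c /operator_coef => e.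
by rewrite positive_operator_hermitian e conjC0.
Qed.

(** The vectors [kernel_coef n] are a bidiagonal combination of the basis, on
    both sides of the form: the combination in the row index is inverted by
    induction on the row, the one in the column index is a recurrence solved
    by [offdiag_coef]. *)
Lemma operator_coef_tridiagonalP :
  (forall m n, (m.+2 <= n)%N || (n.+2 <= m)%N -> operator_coef ip a b f P m n = 0) <->
  (forall m n, (m.+2 <= n)%N ->
     operator_matrix ip f P m n = offdiag_coef a b m n * operator_matrix ip f P m m.+1).
Proof.
have ca n : conjC (a n) != 0 by rewrite conjC_eq0.
apply: (iff_trans u_eq0); rewrite -/p; split=> h m n mn.
  have {mn} : (m < n)%N by exact: ltnW.
  elim: n => [//|n IHn]; rewrite ltnS leq_eqVlt => /predU1P[->|mn].
    by rewrite offdiag_coef1 mul1r.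
  rewrite offdiag_coefS// -mulrA -IHn//.
  have /eqP := h m n.+1 mn; rewrite uS addr_eq0 => /eqP e.
  apply: (mulfI (ca n.+1)); rewrite e mulrA mulrN [_ * (_ / _)]mulrC divfK//.
  by rewrite mulNr.
have {}h j : (m < j)%N -> p m j = offdiag_coef a b m j * p m m.+1.
  by rewrite leq_eqVlt => /predU1P[<-|/h//]; rewrite offdiag_coef1 mul1r.
case: n mn => // n mn; rewrite uS [p m n]h// [p m n.+1]h 1?ltnW// offdiag_coefS//.
by rewrite !mulNr mulrN -!mulrA mulrCA mulVKf// addNr.
Qed.

End Matrix.

Theorem theorem5p2 (R : realType) (H : completeNormedModType R[i])
    (ip : {dot H for conjC}) (ev : H -> R[i] -> R[i])
    (k : R[i] -> R[i] -> R[i]) (kf : R[i] -> H)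
    (a b : nat -> R[i]) (f : nat -> H)
    (hH : tridiagonal_space ip ev k kf a b f)
    (P : {linear H -> H})
    (P_bounded : bounded_operator P) (P_positive : positive_operator ip P)
    (c : nat -> nat -> R[i])
    (P_matrix : forall m n : nat,
       operator_matrix ip f P m n = hermitian_extension c m n) :
  let K := operator_kernel ip kf P in
  [/\ analytic_kernel K,
      tridiagonal_kernel K <->
        (forall n : nat, (2 <= n)%N -> c 0%N n = offdiag_coef a b 0 n * c 0%N 1%N) /\
        (forall m n : nat, (1 <= m)%N -> (m.+2 <= n)%N ->
           c m n = offdiag_coef a b m n * c m m.+1)
    & tridiagonal_kernel K <->
        (forall m n : nat,
           operator_matrix ip f P m n = tridiagonal_matrix a b c m n)].
Proof.
move=> K.
have pc m n : (m <= n)%N -> operator_matrix ip f P m n = c m n.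
  by move=> mn; rewrite P_matrix /hermitian_extension mn.
have Ktri : tridiagonal_kernel K <-> forall m n, (m.+2 <= n)%N ->
    c m n = offdiag_coef a b m n * c m m.+1.
  apply: iff_trans (tridiagonal_kernelP (operator_coef_growth hH P_bounded)
    (operator_kernel_expansion hH P_bounded)) _.
  apply: iff_trans (operator_coef_tridiagonalP P_positive b f (tridiag_a_neq0 hH)) _.
  by split=> h m n mn; have := h m n mn; rewrite !pc// ltnW// ltnW.
split.
- exact: operator_kernel_analytic hH _ P_positive.
- apply: iff_trans Ktri _; split=> [h|[h0 h] [|m] n mn].
  + by split=> [n /h//|m n _ /h].
  + exact: h0.
  + exact: h.
- apply: iff_trans Ktri _; split=> h m n.
    rewrite P_matrix /tridiagonal_matrix /hermitian_extension.
    have e i j : (if (j <= i.+1)%N then c i j else offdiag_coef a b i j * c i i.+1)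
        = c i j.
      by case: leqP => // /h.
    by rewrite !e.
  move=> mn; have := h m n; rewrite pc; last by do 2!apply: ltnW.
  rewrite /tridiagonal_matrix /hermitian_extension.
  by rewrite ifT ?ifN -?ltnNge//; do 2!apply: ltnW.
Qed.
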